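(* Let $q$ be a prime power and $m\ge 9$. Assume that the non-Pappus $q$-matroid $\mathcal{NP}(q)$ equals $\mathcal M[\mathcal C]$ for some $\mathbb F_q$-$[9\times m,3m,d]$ matrix rank-metric code $\mathcal C$. Then $d=6$ and the rank distribution of $\mathcal C$ is $A_0(\mathcal C)=1$, $A_1(\mathcal C)=\dots=A_5(\mathcal C)=0$, $A_6(\mathcal C)=8(q^m-1)$, $A_7(\mathcal C)=(q^m-1)\left(\binom{9}{2}_q-8\binom{3}{1}_q\right)$, $A_8(\mathcal C)=\binom{9}{1}_q(q^{2m}-1)-\binom{3}{1}_qA_6(\mathcal C)-(q+1)A_7(\mathcal C)$, $A_9(\mathcal C)=q^{3m}-1-A_6(\mathcal C)-A_7(\mathcal C)-A_8(\mathcal C)$.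
   Context: Let $E=\mathbb F_q^9$ with standard basis $e_1,\dots,e_9$, and $\mathcal L(E)$ the set of its subspaces. Let $\mathcal S$ be the set of the eight 3-dimensional subspaces $\langle e_i,e_j,e_k\rangle$ for $\{i,j,k\}\in\{\{1,2,3\},\{1,6,8\},\{1,5,7\},\{2,4,7\},\{2,6,9\},\{3,4,8\},\{3,5,9\},\{4,5,6\}\}$. The non-Pappus $q$-matroid is $\mathcal{NP}(q)=(\mathcal L(E),\rho)$ with $\rho(U)=\dim U$ if $\dim U\le3$ and $U\notin\mathcal S$, $\rho(U)=2$ if $U\in\mathcal S$, and $\rho(U)=3$ otherwise. An $\mathbb F_q$-$[9\times m,k',d]$ code is an $\mathbb F_q$-linear subspace $\mathcal C\subseteq\mathbb F_q^{9\times m}$ of dimension $k'$ with minimum rank $d$ over nonzero elements; $\mathcal M[\mathcal C]$ has rank function $\rho_{\mathcal C}(U)=(k'-\dim\mathcal C(U^\perp))/m$ with $\mathcal C(W)=\{M\in\mathcal C:\operatorname{colsp}(M)\subseteq W\}$ and $U^\perp$ the orthogonal complement under the standard dot product. $A_i(\mathcal C)=|\{M\in\mathcal C:\operatorname{rk}(M)=i\}|$. $\binom{a}{b}_q$ denotes the Gaussian binomial coefficient (number of $b$-dimensional subspaces of $\mathbb F_q^a$). *)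

(* Defs.v *)
From HB Require Import structures.
From mathcomp Require Import all_boot all_order all_algebra.

Set Implicit Arguments.
Unset Strict Implicit.
Unset Printing Implicit Defensive.

Import GRing.Theory VectorInternalTheory.
Local Open Scope ring_scope.

HB.instance Definition _ (F : finFieldType) (vT : vectType F) :=
  [Countable of {vspace vT} by <:].
HB.instance Definition _ (F : finFieldType) (vT : vectType F) :=
  [Finite of {vspace vT} by <:].

(* The Gaussian binomial coefficient [a choose b]_q for q = #|F|. *)
Definition gauss_binom (F : finFieldType) (a b : nat) : nat :=
  #|[set U : {vspace 'cV[F]_a} | \dim U == b]|.

Definition colsp (F : fieldType) (n m : nat) (M : 'M[F]_(n, m)) :
    {vspace 'cV[F]_n} :=
  <<[seq col j M | j : 'I_m]>>%VS.

(* The sets spanned in the next two definitions are already subspaces: see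
   mem_orthov and mem_shorten. *)
Definition orthov (F : finFieldType) (n : nat) (U : {vspace 'cV[F]_n}) :
    {vspace 'cV[F]_n} :=
  <<enum [set v : 'cV[F]_n | [forall u in U, u^T *m v == 0%R]]>>%VS.

(* C(W) *)
Definition shorten (F : finFieldType) (n m : nat) (C : {vspace 'M[F]_(n, m)})
    (W : {vspace 'cV[F]_n}) : {vspace 'M[F]_(n, m)} :=
  <<enum [set M : 'M[F]_(n, m) | (M \in C) && (colsp M <= W)%VS]>>%VS.

Definition rank_metric_code (F : fieldType) (n m : nat)
    (C : {vspace 'M[F]_(n, m)}) (k d : nat) : Prop :=
  [/\ \dim C = k,
      exists M : 'M[F]_(n, m), [/\ M \in C, M != 0 & \rank M = d]
    & forall M : 'M[F]_(n, m), M \in C -> M != 0 -> (d <= \rank M)%N].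

(* The rank function of M[C]; a priori it is only rational-valued. *)
Definition code_rank (F : finFieldType) (n m : nat) (C : {vspace 'M[F]_(n, m)})
    (U : {vspace 'cV[F]_n}) : rat :=
  ((\dim C)%:R - (\dim (shorten C (orthov U)))%:R) / m%:R.

Definition rank_dist (F : finFieldType) (n m : nat) (C : {vspace 'M[F]_(n, m)})
    (i : nat) : nat :=
  #|[set M : 'M[F]_(n, m) | (M \in C) && (\rank M == i)]|.

(* The standard basis e_1, ..., e_9, with 1-based indices. *)
Definition std_basis (F : fieldType) (i : nat) : 'cV[F]_9 :=
  delta_mx (inord i.-1) 0.

Definition non_pappus_triples : seq (seq nat) :=
  [:: [:: 1; 2; 3]; [:: 1; 6; 8]; [:: 1; 5; 7]; [:: 2; 4; 7];
      [:: 2; 6; 9]; [:: 3; 4; 8]; [:: 3; 5; 9]; [:: 4; 5; 6]]%N.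

Definition non_pappus_spaces (F : fieldType) : seq {vspace 'cV[F]_9} :=
  [seq <<[seq std_basis F i | i <- t]>>%VS | t <- non_pappus_triples].

Definition non_pappus_rank (F : fieldType) (U : {vspace 'cV[F]_9}) : nat :=
  if (\dim U <= 3)%N && (U \notin non_pappus_spaces F) then \dim U
  else if U \in non_pappus_spaces F then 2%N else 3%N.

Lemma mem_span_enum (F : finFieldType) n m (S : {set 'M[F]_(n, m)}) :
  submod_closed [in S] -> forall x, (x \in <<enum S>>%VS) = (x \in S).
Proof.
move=> [S0 SD] x; apply/idP/idP => [xS | Sx]; last first.
  by apply: memv_span; rewrite mem_enum.
have [c ->] : exists c : 'I_(size (enum S)) -> F,
    x = \sum_i c i *: (enum S)`_i.
  exists (fun i => coord (in_tuple (enum S)) i x).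
  exact: (@coord_span _ _ _ (in_tuple (enum S))).
apply: (big_rec [in S]) => [//|i y _ Sy]; apply: (SD) => //.
by rewrite -mem_enum mem_nth.
Qed.

Lemma mem_orthov (F : finFieldType) n (U : {vspace 'cV[F]_n}) v :
  reflect (forall u, u \in U -> u^T *m v = 0) (v \in orthov U).
Proof.
rewrite mem_span_enum ?inE.
  apply: (iffP forall_inP) => H u /H; first by move/eqP.
  by move->.
split; first by rewrite !inE; apply/forall_inP => u _; rewrite mulmx0.
move=> a x y; rewrite !inE => /forall_inP Hx /forall_inP Hy.
apply/forall_inP => u Uu; rewrite mulmxDr -scalemxAr.
by rewrite (eqP (Hx u Uu)) (eqP (Hy u Uu)) scaler0 addr0.
Qed.

Lemma colsp_subvP (F : fieldType) n m (M : 'M[F]_(n, m)) (W : {vspace 'cV[F]_n}) :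
  reflect (forall j, col j M \in W) (colsp M <= W)%VS.
Proof.
apply: (iffP span_subvP) => [H j | H x /imageP[j _ ->] //].
by apply: H; apply: image_f.
Qed.

Lemma mem_shorten (F : finFieldType) n m (C : {vspace 'M[F]_(n, m)}) W M :
  (M \in shorten C W) = (M \in C) && (colsp M <= W)%VS.
Proof.
rewrite mem_span_enum ?inE //; split.
  rewrite !inE mem0v; apply/colsp_subvP => j.
  by rewrite (_ : col j 0 = 0) ?mem0v //; apply/colP=> i; rewrite !mxE.
move=> a x y; rewrite !inE => /andP[Cx /colsp_subvP Hx] /andP[Cy /colsp_subvP Hy].
rewrite memvD ?memvZ //=; apply/colsp_subvP => j.
rewrite (_ : col j _ = a *: col j x + col j y) ?memvD ?memvZ //.
by apply/colP=> i; rewrite !mxE.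
Qed.

(* Main.v *)
(* For a subspace U, the codewords M with U inside the left kernel (colsp M)^perp
   are those of C(U^perp), so there are q^(m(3 - rho(U))) of them.  As the left
   kernel has dimension 9 - rk M, double counting the pairs (U, M) with dim U = b
   and M nonzero gives
     sum_(dim U = b) (q^(m(3 - rho(U))) - 1) = sum_(i >= 1) A_i * binom(9 - i, b)_q.
   A nonzero codeword of rank at most 5 would lie in C(U^perp) for its left kernel
   U, which has rho(U) = 3, so A_1 = ... = A_5 = 0; then b = 3, 2, 1, 0 determine
   A_6, A_7, A_8, A_9 in turn. *)
Require Import Defs.
From HB Require Import structures.
From mathcomp Require Import all_boot all_order all_algebra.
From mathcomp Require Import finfield zify ring.

Set Implicit Arguments.
Unset Strict Implicit.
Unset Printing Implicit Defensive.

(* Lets Defs.orthov shadow the orthov of sesquilinear forms. *)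
Import Defs.
Import GRing.Theory Num.Theory.
Local Open Scope ring_scope.

(** * Column spaces of matrices and their dimension *)

Section ColumnSpace.

Variables (F : fieldType) (n : nat).

Lemma mulmx_col_sum m (M : 'M[F]_(n, m)) (c : 'cV[F]_m) :
  M *m c = \sum_j c j 0 *: col j M.
Proof.
apply/colP=> i; rewrite mxE summxE; apply: eq_bigr => j _.
by rewrite !mxE mulrC.
Qed.

Lemma mem_colspP m (M : 'M[F]_(n, m)) v :
  reflect (exists c : 'cV[F]_m, v = M *m c) (v \in colsp M).
Proof.
apply: (iffP idP) => [|[c ->]]; last first.
  rewrite mulmx_col_sum; apply: memv_suml => j _; apply: memvZ.
  by apply: memv_span; apply: image_f.
pose f := linfun (mulmx M : 'cV[F]_m -> 'cV[F]_n).
have: (colsp M <= limg f)%VS.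
  apply/colsp_subvP => j; apply/memv_imgP; exists (delta_mx j 0).
    exact: memvf.
  by rewrite lfunE /= -colE.
by move=> /subvP sMf /sMf /memv_imgP[c _ ->]; exists c; rewrite lfunE.
Qed.

(** [col_base M] has the same column space as [M], and its [\rank M] columns are free because it has
    full column rank. *)
Lemma dim_colsp m (M : 'M[F]_(n, m)) : \dim (colsp M) = \rank M.
Proof.
pose B := col_base M.
pose X := [tuple col i B | i < \rank M].
have XE : <<X>>%VS = colsp B.
  by congr span; rewrite /= /image_mem enumT -map_comp.
have freeX : free X.
  apply/freeP => k k0 i.
  have Bk0 : B *m (\col_j k j) = 0.
    rewrite mulmx_col_sum -[RHS]k0; apply: eq_bigr => j _.
    by rewrite -tnth_nth tnth_mktuple mxE.
  have /row_free_inj Binj : row_free B^T.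
    by rewrite /row_free mxrank_tr; apply: col_base_full.
  have : (\col_j k j)^T = 0 :> 'rV_ _.
    by apply: Binj; rewrite -trmx_mul Bk0 mul0mx trmx0.
  by move/rowP/(_ i); rewrite !mxE.
have -> : colsp M = colsp B.
  apply/vspaceP=> v; apply/mem_colspP/mem_colspP => -[c ->].
    by exists (row_base M *m c); rewrite mulmxA mulmx_base.
  (* [row_base M] is row free, so its pseudo-inverse is a right inverse. *)
  exists (pinvmx (row_base M) *m c).
  rewrite -[X in _ = X *m _](mulmx_base M) -mulmxA; congr (_ *m _).
  by rewrite mulmxA mulmxVp ?mul1mx // row_base_free.
by rewrite -XE (eqnP freeX) size_tuple.
Qed.

(** Lets questions about a subspace be settled by matrix algebra; the columns are a basis of [U]. *)
Lemma colspP (U : {vspace 'cV[F]_n}) : exists m (M : 'M[F]_(n, m)), colsp M = U.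
Proof.
exists (\dim U), (\matrix_(i, j) (vbasis U)`_j i 0).
apply/eqP; rewrite eqEsubv -[X in _ && (X <= _)%VS](span_basis (vbasisP U)).
apply/andP; split; last first.
  apply/span_subvP => v /(nthP 0)[j]; rewrite size_tuple => lt_j <-.
  apply: memv_span; apply/imageP; exists (Ordinal lt_j) => //.
  by apply/colP=> i; rewrite !mxE.
apply/colsp_subvP => j.
rewrite (_ : col j _ = (vbasis U)`_j) ?vbasis_mem ?mem_nth ?size_tuple //.
by apply/colP=> i; rewrite !mxE.
Qed.

Lemma dim_cV_le (U : {vspace 'cV[F]_n}) : (\dim U <= n)%N.
Proof. by have := dimvS (subvf U); rewrite dimvf /dim /= muln1. Qed.

End ColumnSpace.

(** * Orthogonal complements under the dot product *)

Section Orthogonal.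

Variables (F : finFieldType) (n : nat).
Implicit Types U V : {vspace 'cV[F]_n}.

Lemma sub_orthovC U V : (U <= orthov V)%VS = (V <= orthov U)%VS.
Proof.
wlog suff imp : U V / (U <= orthov V)%VS -> (V <= orthov U)%VS.
  by apply/idP/idP; apply: imp.
move=> /subvP UV; apply/subvP => v Vv; apply/mem_orthov => u /UV/mem_orthov/(_ v Vv).
by move/(congr1 trmx); rewrite trmx_mul trmxK trmx0.
Qed.

(** Rank-nullity for the transpose of [M], where [U] is the column space of [M]: its kernel is the
    complement of [U]. *)
Lemma dim_orthov U : \dim (orthov U) = (n - \dim U)%N.
Proof.
have [m [M <-]] := colspP U; rewrite dim_colsp.
pose f := linfun (mulmx M^T : 'cV[F]_n -> 'cV[F]_m).
have kerE : lker f = orthov (colsp M).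
  apply/vspaceP => v; rewrite memv_ker lfunE /=; apply/eqP/mem_orthov.
    by move=> Mv0 _ /mem_colspP[c ->]; rewrite trmx_mul -mulmxA Mv0 mulmx0.
  move=> ort; apply/colP=> j; rewrite [RHS]mxE.
  have /ort : col j M \in colsp M.
    by apply/mem_colspP; exists (delta_mx j 0); rewrite -colE.
  move/colP/(_ 0); rewrite [RHS]mxE => <-; rewrite !mxE.
  by apply: eq_bigr => i _; rewrite !mxE.
have imE : limg f = colsp M^T.
  apply/vspaceP => v; apply/memv_imgP/mem_colspP => [[c _ ->]|[c ->]].
    by exists c; rewrite lfunE.
  by exists c; rewrite ?memvf ?lfunE.
have := limg_ker_dim f fullv.
rewrite capfv kerE imE dim_colsp mxrank_tr dimvf /dim /= muln1 => dimE.
by rewrite -[X in (X - _)%N]dimE addnK.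
Qed.

(** A subspace lies in its double complement and the dimensions agree, so isotropic vectors do no
    harm. *)
Lemma orthovK : involutive (@orthov F n).
Proof.
move=> U; apply/eqP; rewrite eq_sym eqEdim sub_orthovC subvv /=.
by rewrite !dim_orthov subKn ?dim_cV_le.
Qed.

End Orthogonal.

(** * Gaussian binomials as counts of subspaces *)

Section GaussianBinomial.

Variable F : finFieldType.

(** Coordinates along a basis of [V] give an injective linear map [f] with image [V]; taking images
    under [f] is then a dimension-preserving bijection on subspaces. *)
Lemma card_subspaces (vT : vectType F) (V : {vspace vT}) (b : nat) :
  #|[set U : {vspace vT} | (U <= V)%VS & \dim U == b]| = gauss_binom F (\dim V) b.
Proof.
pose g (c : 'cV[F]_(\dim V)) : vT := \sum_i c i 0 *: (vbasis V)`_i.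
have g_lin : linear g.
  move=> a x y; rewrite /g scaler_sumr -big_split; apply: eq_bigr => i _ /=.
  by rewrite !mxE scalerDl scalerA.
pose gL := GRing.isLinear.Build F _ _ _ g g_lin.
pose gl : {linear 'cV[F]_(\dim V) -> vT} := HB.pack g gL.
pose f := linfun gl.
have fE c : f c = \sum_i c i 0 *: (vbasis V)`_i by rewrite lfunE.
have finj : lker f == 0%VS.
  apply/lker0P => x y; rewrite !fE => exy; apply/colP => i.
  have freeV := basis_free (vbasisP V).
  by rewrite -(coord_sum_free (fun i => x i 0) i freeV) exy coord_sum_free.
have fim : limg f = V.
  apply/vspaceP => v; apply/memv_imgP/idP => [[c _ ->]|/coord_vbasis ->].
    rewrite fE; apply: memv_suml => i _; apply/memvZ/vbasis_mem.
    by rewrite mem_nth ?size_tuple.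
  exists (\col_i coord (vbasis V) i v); rewrite ?memvf // fE.
  by apply: eq_bigr => i _; rewrite mxE.
have imf_inj : injective (fun U => f @: U)%VS.
  by move=> U W eUW; apply/eqP; rewrite -(eq_limg_ker0 _ _ finj) eUW.
rewrite /gauss_binom -(card_imset _ imf_inj); apply: eq_card => U.
rewrite inE; apply/andP/imsetP => [[sUV /eqP dU]|[W]].
  have imU : (f @: (f @^-1: U))%VS = U by apply: lpreimK; rewrite fim.
  exists (f @^-1: U)%VS; rewrite // inE -dU -{2}imU limg_dim_eq //.
  by rewrite (eqP finj) capv0.
rewrite inE => dW ->; rewrite -[X in (_ <= X)%VS]fim limgS ?subvf // limg_dim_eq //.
by rewrite (eqP finj) capv0.
Qed.

Lemma gauss_binom_small n b : (n < b)%N -> gauss_binom F n b = 0%N.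
Proof.
move=> lt_nb; apply/eqP; rewrite cards_eq0; apply/eqP/setP => U; rewrite !inE.
by apply: contraTF lt_nb => /eqP <-; rewrite -leqNgt dim_cV_le.
Qed.

(** Orthogonal complementation is a bijection between dimensions b and n - b. *)
Lemma gauss_binom_sub n b : (b <= n)%N -> gauss_binom F n (n - b) = gauss_binom F n b.
Proof.
move=> le_bn; rewrite /gauss_binom -(card_imset _ (inv_inj (@orthovK F n))).
apply: eq_card => U; apply/imsetP/idP => [[W]|].
  by rewrite !inE => /eqP dW ->; rewrite dim_orthov dW subKn.
rewrite inE => /eqP dU; exists (orthov U); last by rewrite orthovK.
by rewrite inE dim_orthov dU.
Qed.

Lemma gauss_binom0 n : gauss_binom F n 0 = 1%N.
Proof.
rewrite /gauss_binom (_ : [set _ | _] = [set 0%VS]) ?cards1 //.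
by apply/setP => U; rewrite !inE dimv_eq0.
Qed.

Lemma gauss_binomn n : gauss_binom F n n = 1%N.
Proof. by rewrite -[X in gauss_binom F n X]subn0 gauss_binom_sub ?gauss_binom0. Qed.

(* Each nonzero vector lies on exactly one line. *)
Lemma gauss_binom1 n : (gauss_binom F n 1 * (#|F| - 1) = #|F| ^ n - 1)%N.
Proof.
have -> : (#|F| ^ n - 1 = #|[set v : 'cV[F]_n | v != 0%R]|)%N.
  rewrite -[X in (_ ^ X)%N]muln1 -card_mx -[X in (_ - X)%N](cards1 (0 : 'cV[F]_n)).
  rewrite -cardsT -cardsDS ?subsetT //.
  by apply: eq_card => v; rewrite !inE andbT.
rewrite -[RHS]sum1_card.
rewrite (partition_big (fun v => <[v]>%VS) (fun U => \dim U == 1%N)) /=; last first.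
  by move=> v; rewrite inE dim_vline => ->.
rewrite /gauss_binom -sum_nat_const; under eq_bigl do rewrite inE.
apply: eq_bigr => U /eqP dU.
have -> : (#|F| - 1 = #|[set v | v \in U] :\ 0%R|)%N.
  by rewrite cardsDS ?sub1set ?inE ?mem0v // cards1 cardsE card_vspace dU expn1.
rewrite -sum1_card; apply: eq_bigl => v; rewrite !inE.
case: eqP => //= /eqP v0; rewrite eqEdim dim_vline v0 dU leqnn andbT.
by rewrite memvE.
Qed.

Lemma gauss_binom21 : gauss_binom F 2 1 = #|F|.+1.
Proof.
have q1 := card_finRing_gt1 F.
(* Cancel the positive factor q - 1 in q^2 - 1 = (q + 1)(q - 1). *)
have := gauss_binom1 2; move: #|F| q1 => q q1; nia.
Qed.

End GaussianBinomial.

(** * Moment identities for the rank distribution *)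

Section Moments.

Variables (F : finFieldType) (n m : nat) (C : {vspace 'M[F]_(n, m)}).

Lemma rank_dist0 : rank_dist C 0 = 1%N.
Proof.
rewrite /rank_dist (_ : [set _ | _] = [set 0]) ?cards1 //.
apply/setP => M; rewrite !inE mxrank_eq0.
by case: eqP => [->|_]; rewrite ?mem0v ?andbF.
Qed.

Lemma card_shorten_nonzero W :
  #|[set M in C | (colsp M <= W)%VS & M != 0]| = (#|F| ^ \dim (shorten C W) - 1)%N.
Proof.
rewrite -card_vspace -[X in (_ - X)%N](cards1 (0 : 'M[F]_(n, m))).
rewrite -[X in (X - _)%N]cardsE -cardsDS ?sub1set ?inE ?mem0v //.
by apply: eq_card => M; rewrite !inE mem_shorten andbA andbC.
Qed.

Lemma rank_dist_moment (b : nat) :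
  (\sum_(U : {vspace 'cV[F]_n} | \dim U == b) (#|F| ^ \dim (shorten C (orthov U)) - 1)
   = \sum_(1 <= i < n.+1) rank_dist C i * gauss_binom F (n - i) b)%N.
Proof.
(* Each pair (U, M) is counted by the indicator that U is orthogonal to the column space of M; the
   sums are then exchanged and the codewords grouped by rank. *)
transitivity (\sum_(U : {vspace 'cV[F]_n} | \dim U == b)
    \sum_(M in C | M != 0%R) ((U <= orthov (colsp M))%VS : nat))%N.
  apply: eq_bigr => U _; rewrite -card_shorten_nonzero -sum1_card big_mkcond.
  rewrite [RHS]big_mkcond; apply: eq_bigr => M _.
  by rewrite inE sub_orthovC; do !case: (_ \in _); case: (_ != _); case: (_ <= _)%VS.
rewrite exchange_big /= (eq_bigr (fun M : 'M_(n, m) => gauss_binom F (n - \rank M) b)).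
  rewrite big_add1 /= big_mkord.
  have rankE (M : 'M_(n, m)) (i : 'I_n.+1) :
      (inord (\rank M) == i :> 'I_n.+1) = (\rank M == i).
    by rewrite -val_eqE /= inordK // ltnS rank_leq_row.
  rewrite (partition_big (fun M : 'M_(n, m) => inord (\rank M) : 'I_n.+1) predT) //=.
  (* Only nonzero codewords are summed, so the rank 0 class is empty. *)
  rewrite big_ord_recl big1 ?add0n => [|M]; last first.
    by rewrite rankE mxrank_eq0 -andbA andNb andbF.
  apply: eq_bigr => i _; rewrite -sum_nat_const.
  apply: eq_big => [M|M /andP[_]]; last by rewrite rankE => /eqP ->.
  rewrite inE rankE -mxrank_eq0 -andbA; congr (_ && _).
  by rewrite andb_idl // => /eqP ->.
move=> M _; rewrite -dim_colsp -dim_orthov -card_subspaces -sum1_card.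
rewrite big_mkcond [RHS]big_mkcond; apply: eq_bigr => U _; rewrite inE.
by rewrite andbC; case: ifP; case: (_ <= _)%VS.
Qed.

End Moments.

(** * The eight special subspaces and the rank function *)

Section NonPappus.

Variable F : finFieldType.
Implicit Types (t : seq nat) (U : {vspace 'cV[F]_9}).

(** The dot product with e_i kills every other e_j but not e_i. The range condition matters: by
    [inord], every index outside 1..9 would denote e_1. *)
Lemma mem_std_basis_span t i : all (fun j => 0 < j <= 9)%N (i :: t) ->
  (std_basis F i \in <<[seq std_basis F j | j <- t]>>%VS) = (i \in t).
Proof.
move=> /= /andP[i9 /allP t9]; apply/idP/idP => [|it]; last first.
  by apply: memv_span; apply: map_f.
pose f := linfun (mulmx (std_basis F i)^T : 'cV[F]_9 -> 'cV[F]_1).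
have fE j : (0 < j <= 9)%N -> f (std_basis F j) = (i == j)%:R%:M.
  move=> j9; rewrite lfunE /= /std_basis trmx_delta mul_delta_mx_cond.
  have -> : (inord i.-1 == inord j.-1 :> 'I_9) = (i == j).
    by rewrite -val_eqE /= !inordK; lia.
  by case: eqP => _; apply/matrixP => a b; rewrite !ord1 !mxE ?eqxx.
apply: contraLR => i't; apply/negP => ispan.
have /subvP/(_ _ ispan) : (<<[seq std_basis F j | j <- t]>> <= lker f)%VS.
  apply/span_subvP => _ /mapP[j jt ->]; rewrite memv_ker fE ?t9 //.
  by rewrite (_ : (i == j) = false) ?raddf0 //; apply: contraNF i't => /eqP ->.
rewrite memv_ker fE // eqxx => /eqP/matrixP/(_ 0 0)/eqP.
by rewrite !mxE oner_eq0.
Qed.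

Lemma dim_std_basis_span t : all (fun j => 0 < j <= 9)%N t -> uniq t ->
  \dim <<[seq std_basis F j | j <- t]>> = size t.
Proof.
move=> t9 ut; rewrite -(size_map (std_basis F)); apply/eqP; rewrite -/(free _).
elim: t t9 ut => [|i t IH] /=; first by rewrite nil_free.
move=> t9 /andP[i't ut]; rewrite free_cons mem_std_basis_span //= i't IH //.
by case/andP: t9.
Qed.

Lemma non_pappus_triples_range : all (all (fun j => 0 < j <= 9)%N) non_pappus_triples.
Proof. by []. Qed.

Lemma dim_non_pappus_space U : U \in non_pappus_spaces F -> \dim U = 3%N.
Proof.
have /allP triple : all (fun t => uniq t && (size t == 3%N)) non_pappus_triples by [].
case/mapP => t tS ->; have /andP[ut /eqP sz] := triple t tS.
by rewrite dim_std_basis_span ?(allP non_pappus_triples_range).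
Qed.

(** A triple can be read off its span, as the indices i for which e_i belongs to it. *)
Lemma uniq_non_pappus_spaces : uniq (non_pappus_spaces F).
Proof.
rewrite map_inj_in_uniq // => s t sS tS est.
have {}est : {in iota 1 9, s =i t}.
  move=> i; rewrite mem_iota => i9.
  rewrite -(@mem_std_basis_span s) /=; last first.
    by rewrite i9 (allP non_pappus_triples_range).
  by rewrite est mem_std_basis_span //= i9 (allP non_pappus_triples_range).
(* Each triple is listed in increasing order, so filtering 1..9 returns the same list. *)
have filtE u : u \in non_pappus_triples -> [seq i <- iota 1 9 | i \in u] = u.
  by move=> uS; apply/eqP; move: u uS; apply/allP.
by rewrite -(filtE s) // -(filtE t) //; apply: eq_in_filter.
Qed.

Lemma card_non_pappus_spaces : #|[set U in non_pappus_spaces F]| = 8%N.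
Proof. by rewrite cardsE (card_uniqP uniq_non_pappus_spaces). Qed.

Lemma non_pappus_rank_le3 U : (non_pappus_rank U <= 3)%N.
Proof. by rewrite /non_pappus_rank; case: ifP => [/andP[]|_] //; case: ifP. Qed.

Lemma non_pappus_rank_small U :
  (\dim U <= 2)%N -> non_pappus_rank U = \dim U.
Proof.
move=> dU; rewrite /non_pappus_rank.
have /negbTE -> : U \notin non_pappus_spaces F.
  by apply: contraTN dU => /dim_non_pappus_space ->.
by rewrite (leq_trans dU).
Qed.

Lemma non_pappus_rank_large U : (3 < \dim U)%N -> non_pappus_rank U = 3%N.
Proof.
move=> dU; rewrite /non_pappus_rank leqNgt dU /=.
by case: ifP => // /dim_non_pappus_space dU3; rewrite dU3 in dU.
Qed.

End NonPappus.

(** * Codes representing the non-Pappus q-matroid *)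

Section NonPappusCode.

Variables (F : finFieldType) (m : nat) (C : {vspace 'M[F]_(9, m)}).
Hypotheses (m_gt0 : (0 < m)%N) (dimC : \dim C = (3 * m)%N).
Hypothesis rankC :
  forall U : {vspace 'cV[F]_9}, (non_pappus_rank U)%:R = code_rank C U.
Implicit Type U : {vspace 'cV[F]_9}.

Let q := #|F|.

(** Clearing the denominator [m] in the rank function; the truncated subtraction is exact since the
    rank is at most 3. *)
Lemma dim_shorten_orthov U :
  \dim (shorten C (orthov U)) = (m * (3 - non_pappus_rank U))%N.
Proof.
have m0 : m%:R != 0 :> rat by rewrite pnatr_eq0 -lt0n.
have := rankC U; rewrite /code_rank dimC => /(congr1 ( *%R^~ m%:R)) /eqP.
rewrite /= divfK // eq_sym subr_eq -natrM -natrD eqr_nat => /eqP dE.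
have := non_pappus_rank_le3 U; nia.
Qed.

Lemma code_rank_ge6 M : M \in C -> M != 0 -> (6 <= \rank M)%N.
Proof.
move=> CM; apply: contraNT; rewrite -ltnNge => rM.
have : M \in shorten C (orthov (orthov (colsp M))) by rewrite mem_shorten CM orthovK /=.
suff /eqP -> : shorten C (orthov (orthov (colsp M))) == 0%VS by rewrite memv0.
(* The complement of the column space has dimension 9 - rk M, which is at least 4. *)
rewrite -dimv_eq0 dim_shorten_orthov non_pappus_rank_large ?muln0 //.
by rewrite dim_orthov dim_colsp; lia.
Qed.

Lemma rank_dist_lt6 i : (1 <= i <= 5)%N -> rank_dist C i = 0%N.
Proof.
move=> i5; apply/eqP; rewrite cards_eq0; apply/eqP/setP => M; rewrite !inE.
apply/negP => /andP[CM /eqP rM]; have := code_rank_ge6 CM.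
by rewrite -mxrank_eq0 rM => /(_ _); lia.
Qed.

Lemma non_pappus_moment (b : nat) :
  (\sum_(U : {vspace 'cV[F]_9} | \dim U == b) (q ^ (m * (3 - non_pappus_rank U)) - 1)
   = rank_dist C 6 * gauss_binom F 3 b + rank_dist C 7 * gauss_binom F 2 b
     + rank_dist C 8 * gauss_binom F 1 b + rank_dist C 9 * gauss_binom F 0 b)%N.
Proof.
transitivity (\sum_(1 <= i < 10) rank_dist C i * gauss_binom F (9 - i) b)%N.
  rewrite -rank_dist_moment; apply: eq_bigr => U _.
  by rewrite dim_shorten_orthov.
do 9!rewrite big_nat_recl //.
do 5!rewrite rank_dist_lt6 //.
by rewrite big_geq // !mul0n !add0n addn0 !addnA.
Qed.

Lemma non_pappus_moment_small (b : nat) : (b <= 2)%N ->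
  (\sum_(U : {vspace 'cV[F]_9} | \dim U == b) (q ^ (m * (3 - non_pappus_rank U)) - 1)
   = gauss_binom F 9 b * (q ^ (m * (3 - b)) - 1))%N.
Proof.
move=> b2; rewrite /gauss_binom -sum_nat_const.
apply: eq_big => [U|U /eqP dU]; first by rewrite inE.
by rewrite non_pappus_rank_small dU.
Qed.

(** For b = 3, a subspace outside the special eight has rank 3 and contributes q^0 - 1 = 0, while
    each of the eight contributes q^m - 1. *)
Lemma rank_dist6 : rank_dist C 6 = (8 * (q ^ m - 1))%N.
Proof.
have := non_pappus_moment 3%N.
rewrite gauss_binomn !gauss_binom_small // !muln0 !addn0 muln1 => <-.
rewrite -[X in (X * _)%N](card_non_pappus_spaces F) -sum_nat_const.
rewrite (bigID [in non_pappus_spaces F]) /=.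
rewrite [X in (_ + X)%N]big1 ?addn0 => [|U /andP[/eqP dU US]]; last first.
  by rewrite /non_pappus_rank dU US /= subnn muln0.
apply: eq_big => [U|U /andP[_ US]].
  by rewrite in_set andb_idl // => /dim_non_pappus_space ->.
by rewrite /non_pappus_rank US andbF muln1.
Qed.

Lemma rank_dist_moment2 :
  (rank_dist C 6 * gauss_binom F 3 1 + rank_dist C 7
   = gauss_binom F 9 2 * (q ^ m - 1))%N.
Proof.
have := non_pappus_moment 2%N; rewrite non_pappus_moment_small // muln1 => ->.
rewrite gauss_binomn (@gauss_binom_small _ 0 2) // (@gauss_binom_small _ 1 2) //.
(* The moment produces binom(3,2), which duality turns into binom(3,1). *)
rewrite -(@gauss_binom_sub _ 3 1) //.
by rewrite !muln0 muln1 !addn0.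
Qed.

Lemma rank_dist_moment1 :
  (rank_dist C 6 * gauss_binom F 3 1 + rank_dist C 7 * q.+1 + rank_dist C 8
   = gauss_binom F 9 1 * (q ^ (2 * m) - 1))%N.
Proof.
have := non_pappus_moment 1%N; rewrite non_pappus_moment_small // [(m * _)%N]mulnC => ->.
by rewrite gauss_binom21 gauss_binomn (@gauss_binom_small _ 0 1) // muln0 muln1 addn0.
Qed.

Lemma rank_dist_moment0 :
  (rank_dist C 6 + rank_dist C 7 + rank_dist C 8 + rank_dist C 9 = q ^ (3 * m) - 1)%N.
Proof.
have := non_pappus_moment 0%N; rewrite non_pappus_moment_small // !gauss_binom0.
by rewrite !muln1 mul1n subn0 [(m * _)%N]mulnC => <-.
Qed.

End NonPappusCode.

(** * Minimum rank and rank distribution *)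

Theorem theorem5p5 (F : finFieldType) (q m d : nat) (C : {vspace 'M[F]_(9, m)})
    (hq : #|F| = q) (hm : (9 <= m)%N)
    (hC : rank_metric_code C (3 * m) d)
    (hNP : forall U : {vspace 'cV[F]_9}, (non_pappus_rank U)%:R = code_rank C U) :
  let A (i : nat) : int := (rank_dist C i)%:Z in
  let binq (a b : nat) : int := (gauss_binom F a b)%:Z in
  let Q : int := q%:Z in
  d = 6%N /\
  A 0%N = 1 /\
  (forall i : nat, (1 <= i <= 5)%N -> A i = 0) /\
  A 6%N = 8 * (Q ^+ m - 1) /\
  A 7%N = (Q ^+ m - 1) * (binq 9%N 2%N - 8 * binq 3%N 1%N) /\
  A 8%N = binq 9%N 1%N * (Q ^+ (2 * m) - 1) - binq 3%N 1%N * A 6%N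
          - (Q + 1) * A 7%N /\
  A 9%N = Q ^+ (3 * m) - 1 - A 6%N - A 7%N - A 8%N.
Proof.
case: hC => dimC [M [CM M0 rM]] dmin A binq Q.
have m_gt0 : (0 < m)%N by apply: leq_trans hm.
have q_gt1 : (1 < q)%N by rewrite -hq; apply: card_finRing_gt1.
have A6 := rank_dist6 m_gt0 dimC hNP.
have A7 := rank_dist_moment2 m_gt0 dimC hNP.
have A8 := rank_dist_moment1 m_gt0 dimC hNP.
have A9 := rank_dist_moment0 m_gt0 dimC hNP.
(* Since q^k is at least 1, the truncated subtraction agrees with the integer one. *)
have qE k : (q ^ k - 1)%N%:Z = Q ^+ k - 1.
  by rewrite -subzn ?expn_gt0 1?ltnW // -natz natrX natz.
split.
  (* The codeword [M] attaining the minimum gives 6 <= d; conversely, 8(q^m - 1) is positive, so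
     some codeword has rank 6. *)
  apply/eqP; rewrite eqn_leq -{2}rM (code_rank_ge6 m_gt0 dimC hNP) // andbT.
  have /card_gt0P[N] : (0 < rank_dist C 6)%N.
    by rewrite A6 hq muln_gt0 subn_gt0 /= -(exp1n m) ltn_exp2r.
  rewrite inE => /andP[CN /eqP rN]; rewrite -rN; apply: dmin => //.
  by rewrite -mxrank_eq0 rN.
split; first by rewrite /A rank_dist0.
split; first by move=> i /(rank_dist_lt6 m_gt0 dimC hNP); rewrite /A => ->.
rewrite hq in A6 A7 A8 A9.
move: (congr1 Posz A6) (congr1 Posz A7) (congr1 Posz A8) (congr1 Posz A9).
rewrite !(PoszM, PoszD) !qE -!/(A _) -!/(binq _ _) => {}A6 {}A7 {}A8 {}A9.
(* Substitute the value of A_6 and factor out q^m - 1. *)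
have {}A7 : A 7%N = (Q ^+ m - 1) * (binq 9%N 2%N - 8 * binq 3%N 1%N) by lia.
do 2!split=> //.
split; first by rewrite -A8 intS -/Q; ring.
by rewrite -A9; ring.
Qed.
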